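(* Let $X$ be a real Banach space, let $U$ be a nonempty, bounded and closed subset of $X$ with $\operatorname{int}(U)\neq\emptyset$, and let $f:U\to X$ be a completely continuous mapping. Suppose that there exist a functional $[\![\cdot,\cdot]\!]:X\times X\to\mathbb{R}$ satisfying (i) $[\![x,x]\!]>0$ for all $x\in X$ with $x\neq 0$, and (ii) $[\![\lambda x,x]\!]=\lambda[\![x,x]\!]$ for all $x\in X$ and $\lambda\in\mathbb{R}$, and a point $z\in\operatorname{int}(U)$ such that $[\![f(x),x-z]\!]$ has a constant sign for all $x\in\partial U$ (that is, either $[\![f(x),x-z]\!]\geq 0$ for all $x\in\partial U$, or $[\![f(x),x-z]\!]\leq 0$ for all $x\in\partial U$). Then $0\in\overline{f(U)}$. Moreover, if $0\notin\partial f(U)\setminus f(U)$, then $0\in f(U)$.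
   Context: For a subset $C$ of $X$, $\overline{C}$, $\partial C$ and $\operatorname{int}(C)$ denote its norm closure, boundary and interior in $X$; $\partial f(U)$ is the boundary of the set $f(U)$. A mapping $f:K\to X$ defined on a nonempty subset $K$ of $X$ is called compact if $f(C)$ is relatively compact whenever $C$ is a bounded subset of $K$; it is called completely continuous if it is compact and continuous on $K$. No continuity or other property of the functional $[\![\cdot,\cdot]\!]$ is assumed beyond (i) and (ii). *)

(* Defs.v *)
From HB Require Import structures.
From mathcomp Require Import all_boot all_order all_algebra.
From mathcomp Require Import all_classical all_reals topology normedtype.

Set Implicit Arguments.
Unset Strict Implicit.
Unset Printing Implicit Defensive.

Import Order.TTheory GRing.Theory Num.Theory.
Import numFieldNormedType.Exports.

Local Open Scope classical_set_scope.
Local Open Scope ring_scope.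

Definition boundary (T : topologicalType) (A : set T) : set T :=
  closure A `\` interior A.

(* A mapping K -> X is represented by a total function X -> X of which only
   the values on K are used. By [precompactE], [precompact A] is
   [compact (closure A)]. *)
Definition compact_mapping (R : realType) (X : normedModType R)
    (K : set X) (f : X -> X) : Prop :=
  forall C : set X, C `<=` K -> bounded_set C -> precompact (f @` C).

Definition completely_continuous (R : realType) (X : normedModType R)
    (K : set X) (f : X -> X) : Prop :=
  compact_mapping K f /\ {within K, continuous f}.

(* Main.v *)
(** Suppose that [0] is not in the closure of [f U], and let [d x] be the
    distance from [x] to the complement of [U], cut off at [1].  For every [k],
    Schauder's approximation of [f] by maps into convex hulls of finite sets
    turns the equation [x = z - (s k d x) f x] into a fixed-point problem on a
    simplex, so Brouwer's theorem gives points [x_k] of [U] that solve it up to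
    a small error in [f].  As [x_k - z] is bounded and [f x_k] stays away from
    [0], the numbers [k * d x_k] are bounded; hence [d x_k] tends to [0], and by
    compactness some [x] in the boundary of [U] satisfies [x - z = - s r f x]
    with [r >= 0], which contradicts the sign condition when [s] is [1] or [-1]
    according to the sign.

    Brouwer's theorem on the simplex comes from Scarf's lemma, which needs no
    triangulation: rank the points of a grid by each barycentric coordinate and
    label [x] by some [i] with [x_i <= (g x)_i].  Scarf's lemma provides a set of
    grid points that is small, since it is not bettered in all the coordinates
    of its labels at once. *)

Require Import Defs.
From HB Require Import structures.
From mathcomp Require Import all_boot all_order all_algebra.
From mathcomp Require Import all_classical all_reals topology normedtype.
From mathcomp Require Import sequences zify lra.

Import Order.TTheory GRing.Theory Num.Theory.
Import numFieldNormedType.Exports.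

Local Open Scope classical_set_scope.
Local Open Scope ring_scope.

Set Implicit Arguments.
Unset Strict Implicit.

(** * Scarf's lemma *)

(** Scarf's primitive sets. For [y] in [S] the condition makes [y] a minimum of [S] for some index,
    so with injective ranks [S] has at most as many members as there are indices. *)
Definition dominant (V N : finType) (r : N -> V -> nat) (S : {set V}) : bool :=
  [forall y, exists i, [forall s in S, (r i y <= r i s)%N]].

Lemma dominantP (V N : finType) (r : N -> V -> nat) (S : {set V}) :
  reflect (forall y, exists i, forall s, s \in S -> (r i y <= r i s)%N)
          (dominant r S).
Proof.
apply: (iffP forallP) => H y; have := H y.
  by move=> /existsP[i /forall_inP Hi]; exists i.
by move=> [i Hi]; apply/existsP; exists i; apply/forall_inP.
Qed.

Lemma imset_card_inj (V N : finType) (f : V -> N) (A : {set V}) (B : {set N}) :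
  f @: A = B -> #|B| = #|A| -> {in A &, injective f}.
Proof. by move=> <- eqAB; apply/imset_injP/eqP. Qed.

(** The pivot step. Every member of [D] is its minimum for some index, and there is one index more
    than members, so two indices share a minimum; a new vertex has to relieve one of these two. The
    last hypothesis provides candidates in both cases. *)
Lemma door_two_rooms (V N : finType) (r : N -> V -> nat) (D : {set V}) :
  (forall i, injective (r i)) -> dominant r D -> #|D|.+1 = #|N| ->
  D != finset.set0 ->
  (forall j, exists y, forall i, i != j -> exists2 s, s \in D & (r i s < r i y)%N) ->
  #|[set x in ~: D | dominant r (x |: D)]%SET| = 2.
Proof.
move=> r_inj /dominantP domD cardD /set0Pn[s0 s0D] ext.
pose m i := [arg min_(s < s0 in D) r i s].
have mD i : m i \in D by rewrite /m; case: arg_minnP.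
have mle i s : s \in D -> (r i (m i) <= r i s)%N.
  by rewrite /m; case: arg_minnP => // x _ H /H.
have m_uniq i x : (forall s, s \in D -> (r i x <= r i s)%N) -> x \in D -> x = m i.
  by move=> Hx xD; apply: (r_inj i); apply/eqP; rewrite eqn_leq Hx ?mle.
have m_surj s : s \in D -> exists i, s = m i.
  by move=> sD; have [i Hi] := domD s; exists i; exact: m_uniq.
have [j [k [jk mjk]]] : exists j k, j != k /\ m j = m k.
  have [/injectiveP inj|/injectivePn[j [k jk mjk]]] := boolP (injectiveb m).
    have := subset_leq_card (_ : m @: [set: N] \subset D)%SET.
    rewrite (card_imset _ inj) cardsT -cardD ltnn => H; suff: false by [].
    by apply: H; apply/fintype.subsetP => _ /imsetP[i _ ->].
  by exists j, k.
have inj_but a b : a != b -> m a = m b -> {in [set~ a]%SET &, injective m}.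
  move=> ab mab; apply: (@imset_card_inj _ _ _ _ D); last first.
    by have := cardsC1 a; rewrite -cardD.
  apply/setP => s; apply/imsetP/idP => [[i _ ->]//|/m_surj[i ->]].
  have [->|ia] := eqVneq i a; last by exists i; rewrite ?inE.
  by exists b; rewrite ?inE // eq_sym.
(* A room containing [D] arises by giving up the minimum of [D] for one of the two
   indices [j], [k] that share it: the new vertex is the largest one, for that index,
   among the vertices above the minima of [D] for all other indices. *)
pose M a := [set y | [forall i, (i != a) ==> (r i (m i) < r i y)%N]]%SET.
have MP a y : reflect (forall i, i != a -> (r i (m i) < r i y)%N) (y \in M a).
  by rewrite inE; apply: (iffP forallP) => H i; apply/implyP/H.
have Mx a : exists2 x, x \in M a & forall y, y \in M a -> (r a y <= r a x)%N.
  have [y0 Hy0] := ext a.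
  have My0 : y0 \in M a.
    by apply/MP => i /Hy0[s sD]; apply: leq_ltn_trans (mle _ _ sD).
  by exists [arg max_(x > y0 in M a) r a x]; case: arg_maxnP.
have M_room a x : x \in M a -> (forall y, y \in M a -> (r a y <= r a x)%N) ->
    dominant r (x |: D).
  move=> xM xmax; apply/dominantP => y; have [yM|/MP yM] := boolP (y \in M a).
    have [i Hi] := domD y; have [ia|ia] := eqVneq i a.
      exists a => s /setU1P[->|]; first exact: xmax.
      by rewrite -ia; exact: Hi.
    by move/MP: yM => /(_ i ia); rewrite ltnNge Hi.
  have [i ia iy] : exists2 i, i != a & (r i y <= r i (m i))%N.
    apply: contrapT => H; apply: yM => i ia; rewrite ltnNge; apply/negP => iy.
    by apply: H; exists i.
  exists i => s /setU1P[->|sD]; last exact: leq_trans iy (mle _ _ sD).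
  by apply: (leq_trans iy); apply: ltnW; move/MP: xM; exact.
have M_notin a b x : a != b -> m a = m b -> x \in M a -> x \notin D.
  move=> ab mab /MP xM; apply/negP => /m_surj[i xi].
  have [ia|ia] := eqVneq i a; last by have := xM i ia; rewrite xi ltnn.
  by have := xM b; rewrite eq_sym ab xi ia mab ltnn => /(_ isT).
have room_M x : x \notin D -> dominant r (x |: D) -> exists2 a, (a == j) || (a == k) &
    x \in M a /\ forall y, y \in M a -> (r a y <= r a x)%N.
  move=> xD /dominantP dom.
  have [g gP] := choice dom.
  (* Each member of a room is minimal for its own index, so counting makes [g] a bijection from the
     room onto [N]. The new vertex takes one index [b], and the minima of [D] survive at all others.
     Hence [b] is [j] or [k]: the vertex [m j], equal to [m k], can keep only one of them. *)
  have g_inj : {in x |: D &, injective g}.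
    move=> s t sD tD gst; apply: (r_inj (g s)); apply/eqP.
    by rewrite eqn_leq gP // gst gP.
  have g_surj i : exists2 s, s \in x |: D & i = g s.
    apply/imsetP; suff -> : g @: (x |: D)%SET = [set: N]%SET by rewrite inE.
    apply/eqP; rewrite eqEcard finset.subsetT cardsT (card_in_imset g_inj).
    by rewrite cardsU1 xD -cardD add1n leqnn.
  pose b := g x.
  have bm i : i != b -> (r i (m i) < r i x)%N.
    move=> ib; have [s sxD iE] := g_surj i.
    have sx : s != x by apply: contraNneq ib => e; rewrite iE e.
    have sD : s \in D by move: sxD; rewrite !inE (negPf sx).
    have -> : m i = s.
      by apply/esym/m_uniq => // t tD; rewrite iE gP // inE tD orbT.
    rewrite ltn_neqAle iE gP ?inE ?eqxx // andbT.
    by apply: contra_neq sx => e; apply: r_inj e.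
  exists b.
    apply: contraT; rewrite negb_or => /andP[bj bk].
    have [s sxD jE] := g_surj j; have [t txD kE] := g_surj k.
    have sx : s != x by apply: contraNneq bj => e; rewrite jE e.
    have tx : t != x by apply: contraNneq bk => e; rewrite kE e.
    have sD : s \in D by move: sxD; rewrite !inE (negPf sx).
    have tD : t \in D by move: txD; rewrite !inE (negPf tx).
    have ms : s = m j by apply: m_uniq => // u uD; rewrite jE gP // inE uD orbT.
    have mt : t = m k by apply: m_uniq => // u uD; rewrite kE gP // inE uD orbT.
    by move: jk; rewrite jE kE ms mt mjk eqxx.
  split; first exact/MP.
  move=> y /MP yM; have [i iy] := dom y.
  have [<-|ib] := eqVneq i b; first by apply: iy; rewrite setU11.
  by have := yM i ib; rewrite ltnNge iy // inE mD orbT.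
have [xj xjM xjmax] := Mx j; have [xk xkM xkmax] := Mx k.
have -> : [set x in ~: D | dominant r (x |: D)]%SET = [set xj; xk]%SET.
  apply/setP => x; rewrite !inE; apply/andP/orP => [[xD dom]|].
    have [a /orP[]/eqP-> [xM xmax]] := room_M x xD dom; [left|right]; apply/eqP.
      by apply: (r_inj j); apply/eqP; rewrite eqn_leq xjmax ?xmax.
    by apply: (r_inj k); apply/eqP; rewrite eqn_leq xkmax ?xmax.
  move=> []/eqP->; split.
  - exact: (M_notin j k).
  - exact: (M_room j).
  - by apply: (M_notin k j) => //; rewrite eq_sym.
  - exact: (M_room k).
rewrite cards2; case: eqVneq => // xjk.
(* A vertex in both [M j] and [M k] would exceed the minima of [D] for every index, against
   dominance. *)
have [i ix] := domD xj.
have [ij|ij] := eqVneq i j.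
  move/MP: xkM => /(_ j jk); rewrite -xjk ltnNge -{1}ij.
  by rewrite ij in ix; rewrite ij ix.
by move/MP: xjM => /(_ i ij); rewrite ltnNge ix.
Qed.

(** A face [S :\ e] with all colours but [i0] has no colour twice, so [e] repeats the colour of
    exactly one other member [e'], and only [e] and [e'] can be removed. Such faces number none or
    two. *)
Lemma even_almost_full_faces (V N : finType) (c : V -> N) (i0 : N) (S : {set V}) :
  #|S| = #|N| -> c @: S != [set: N]%SET ->
  ~~ odd #|[set e in S | c @: (S :\ e) == [set~ i0]]%SET|.
Proof.
move=> cardS not_full; set F := finset _.
have [->|/set0Pn[e]] := eqVneq F finset.set0; first by rewrite cards0.
rewrite inE => /andP[eS /eqP ce].
have c_inj : {in S :\ e &, injective c}.
  apply: (imset_card_inj ce); have := cardsD1 e S.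
  by have := cardsC1 i0; rewrite eS cardS; lia.
have ce0 : c e != i0.
  apply: contraNneq not_full => ce_i0; apply/eqP/setP => i.
  have [->|ii0] := eqVneq i i0; first by rewrite -{1}ce_i0 imset_f ?inE.
  have : i \in c @: (S :\ e) by rewrite ce !inE.
  by move=> /imsetP[x /setD1P[_ xS] ->]; rewrite imset_f ?inE.
have : c e \in c @: (S :\ e) by rewrite ce !inE.
move=> /imsetP[e' e'Se cee']; have /setD1P[e'e e'S] := e'Se.
suff -> : F = [set e; e']%SET by rewrite cards2 eq_sym e'e.
apply/setP => x; rewrite !inE; apply/andP/orP => [[xS /eqP cx]|[]/eqP->]; last 2 first.
- by rewrite eS ce.
- rewrite e'S -ce finset.eqEsubset; split=> //.
  apply/andP; split; apply/fintype.subsetP => i.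
    move=> /imsetP[y /setD1P[ye' yS] ->]; have [->|ye] := eqVneq y e.
      by rewrite cee' imset_f.
    by rewrite imset_f // !inE ye.
  move=> /imsetP[y /setD1P[ye yS] ->]; have [->|ye'] := eqVneq y e'.
    by rewrite -cee' imset_f // !inE eq_sym e'e.
  by rewrite imset_f // !inE ye'.
have [_|xe] := eqVneq x e; first by left.
have [_|xe'] := eqVneq x e'; first by right.
have xSe : x \in S :\ e by rewrite !inE xe.
have : c x \in c @: (S :\ x) by rewrite cx -ce imset_f.
move=> /imsetP[y /setD1P[yx yS] cxy]; have [ye|ye] := eqVneq y e.
  by move: xe'; rewrite (c_inj _ _ xSe e'Se) ?eqxx // cxy ye.
by move: yx; rewrite (c_inj _ _ xSe _ cxy) ?eqxx // !inE ye.
Qed.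

Lemma odd_sum (I : finType) (P : pred I) (F : I -> nat) :
  (forall i, P i -> ~~ odd (F i)) -> ~~ odd (\sum_(i | P i) F i)%N.
Proof.
move=> H; elim/big_ind: _ => // x y; rewrite oddD.
by move=> /negPf-> /negPf->.
Qed.

(* Scarf's slack vertices: [inr j] is minimal for the order of index [j] and
   larger than every [inl x] for all other orders. *)
Definition slack_rank (T N : finType) (r : N -> T -> nat) (i : N) (v : T + N) :=
  match v with
  | inl x => (r i x).+1
  | inr j => if j == i then 0%N else ((\max_x r i x).+2 + enum_rank j)%N
  end.

Lemma slack_rank_inj (T N : finType) (r : N -> T -> nat) (i : N) :
  injective (r i) -> injective (slack_rank r i).
Proof.
move=> r_inj; have le x : (r i x <= \max_x r i x)%N by exact: leq_bigmax.
move=> [x|j] [y|k] //=.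
- by move=> [/r_inj->].
- by have := le x; case: eqP => // _; lia.
- by have := le y; case: eqP => // _; lia.
- case: eqP => [->|_]; case: eqP => [->|_] //.
  by move=> /eqP; rewrite eqn_add2l => /eqP/ord_inj/enum_rank_inj->.
Qed.

Lemma lt_slack_rank (T N : finType) (r : N -> T -> nat) (i j : N) (x : T) :
  j != i -> (slack_rank r i (inl x) < slack_rank r i (inr j))%N.
Proof.
move=> /negPf /= ->; have : (r i x <= \max_x r i x)%N by exact: leq_bigmax.
by lia.
Qed.

Theorem scarf (T N : finType) (r : N -> T -> nat) (c : T -> N) :
  (forall i, injective (r i)) -> (0 < #|T|)%N ->
  exists s : {set T}, forall y, exists2 i, i \in c @: s &
    forall x, x \in s -> (r i y <= r i x)%N.
Proof.
move=> r_inj /card_gt0P[t0 _]; pose i0 := c t0.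
pose V : finType := (T + N)%type; pose rho := slack_rank r.
have rho_inj i : injective (rho i) by exact/slack_rank_inj.
pose col (v : V) := match v with inl x => c x | inr j => j end.
suff [S [domS cardS fullS]] : exists S : {set V},
    [/\ dominant rho S, #|S| = #|N| & col @: S = [set: N]%SET].
  (* Slack vertices can be discarded: the member coloured [i] is not the slack vertex of [i], which
     ranks below [inl y] for that index. *)
  exists [set x | inl x \in S]%SET => y.
  have [i Hi] := dominantP _ _ domS (inl y).
  exists i.
    have : i \in col @: S by rewrite fullS.
    move=> /imsetP[[x|j] vS iE]; first by rewrite iE /= imset_f ?inE.
    by have := Hi _ vS; rewrite /rho /= iE eqxx.
  by move=> x; rewrite inE => /Hi.
apply: contrapT => nofull.
pose room (S : {set V}) := dominant rho S && (#|S| == #|N|).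
pose door (D : {set V}) := (col @: D == [set~ i0]%SET) && (#|D|.+1 == #|N|).
(* Double counting of the incidences between rooms and doors: a room that is not
   fully coloured has an even number of doors, and a door lies in two rooms or in
   none, except that the door [D0] made of slack vertices lies in exactly one. *)
have count : (\sum_(S | room S) #|[set e in S | col @: (S :\ e) == [set~ i0]]%SET|)%N =
    (\sum_(D | door D) #|[set x in ~: D | dominant rho (x |: D)]%SET|)%N.
  have card1 (P : pred {set V}) (Q : {set V} -> pred V) :
      (\sum_(A | P A) #|[set x | Q A x]%SET| = \sum_(p | P p.1 && Q p.1 p.2) 1)%N.
    rewrite -(pair_big_dep P Q (fun _ _ => 1%N)); apply: eq_bigr => A _.
    by rewrite sum1dep_card.
  rewrite !card1.
  rewrite (reindex_onto (fun p : {set V} * V => (p.2 |: p.1, p.2))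
     (fun p => (p.1 :\ p.2, p.2))) /=; last first.
    by move=> [S e] /andP[_ /andP[/= eS _]]; rewrite finset.setD1K.
  apply: eq_bigl => -[D x] /=; rewrite xpair_eqE eqxx andbT !inE eqxx /=.
  have [xD|xD] := boolP (x \in D).
    rewrite /= andbF; apply/negP => /andP[_ /eqP/setP/(_ x)].
    by rewrite !inE eqxx xD.
  have -> : (x |: D) :\ x = D by rewrite finset.setU1K.
  rewrite /room /door cardsU1 xD add1n eqxx andbT /= [RHS]andbC -!andbA.
  by do !bool_congr.
have : odd (\sum_(S | room S) #|[set e in S | col @: (S :\ e) == [set~ i0]]%SET|)%N.
  pose D0 : {set V} := inr @: [set~ i0]%SET.
  have inr_inj : injective (@inr T N) by move=> ? ? [].
  have doorD0 : door D0.
    rewrite /door -imset_comp (eq_imset _ (g := id)) // imset_id eqxx /=.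
    by rewrite card_imset // cardsC1 prednK //; apply/card_gt0P; exists i0.
  have in_D0 v : (v \in D0) = if v is inr j then j != i0 else false.
    case: v => [x|j]; last by rewrite mem_imset // !inE.
    by apply/imsetP => -[].
  rewrite count (bigD1 D0) //= oddD; set b := odd (\sum_(_ | _) _)%N.
  have -> : b = false.
    rewrite /b; apply/negbTE; apply: odd_sum => D /andP[/andP[/eqP colD /eqP cardD] DD0].
    (* Otherwise [D] would lie in [D0] and equal it by cardinality. This [inl x] is below the slack
       vertex of [j] for all indices but [j], as the pivot lemma requires. *)
    have [x xD] : exists x, inl x \in D.
      apply: contrapT => noT; case/eqP: DD0; apply/eqP; rewrite eqEcard.
      rewrite -ltnS cardD; move: doorD0 => /andP[_ /eqP->]; rewrite leqnn andbT.
      apply/fintype.subsetP => -[x|j] vD; first by case: noT; exists x.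
      rewrite in_D0; have : col (inr j) \in col @: D by rewrite imset_f.
      by rewrite colD !inE.
    have [domD|ndomD] := boolP (dominant rho D); last first.
      rewrite (_ : [set _ in _ | _]%SET = finset.set0) ?cards0 //.
      apply/setP => y; rewrite !inE; apply/negP => /andP[_ /dominantP domy].
      case/negP: ndomD; apply/dominantP => u; have [i Hi] := domy u.
      by exists i => s sD; apply: Hi; rewrite !inE sD orbT.
    rewrite door_two_rooms //; first by apply/set0Pn; exists (inl x).
    move=> j; exists (inr j) => i ij; exists (inl x) => //.
    by apply: lt_slack_rank; rewrite eq_sym.
  rewrite addbF.
  (* For [inl y] only the index [i0] can work, since every other index has its slack vertex, of rank
     0, in [D0]. So [D0] is completed only by the vertex ranked highest for [i0] among the
     [inl x]. *)
  pose x0 := [arg max_(x > t0) r i0 x].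
  have x0max x : (r i0 x <= r i0 x0)%N by rewrite /x0; case: arg_maxnP => // ? _; apply.
  rewrite (_ : [set _ in _ | _]%SET = [set inl x0]%SET) ?cards1 //.
  apply/setP => v; rewrite !inE in_D0; apply/andP/eqP => [[vD0 /dominantP dom]|->].
    have key y : if v is inl x return Prop then (r i0 y <= r i0 x)%N else False.
      have [i Hi] := dom (inl y).
      have ii0 : i = i0.
        apply/eqP/negPn/negP => ii0; have := Hi (inr i).
        by rewrite !inE in_D0 ii0 orbT /rho /= eqxx => /(_ isT).
      have := Hi v; rewrite setU11 => /(_ isT); case: {dom Hi} v vD0 => [x|j] /=.
        by rewrite ii0.
      by rewrite negbK => /eqP->; rewrite ii0 eqxx.
    case: v {vD0 dom} key => [x|j] key; last by have := key t0.
    by congr inl; apply: (r_inj i0); apply/eqP; rewrite eqn_leq x0max key.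
  split=> //; apply/dominantP => -[y|j].
    exists i0 => s /setU1P[->|]; first by rewrite /rho /= ltnS.
    rewrite in_D0; case: s => // j ji0; apply: ltnW; exact: lt_slack_rank.
  by exists j => s _; rewrite /rho /= eqxx.
apply/negP; apply: odd_sum => S /andP[domS /eqP cardS].
apply: even_almost_full_faces => //; apply/eqP => fullS.
by apply: nofull; exists S.
Qed.

(** * Brouwer's theorem on the simplex *)

(** Scarf's lemma on the integer points with coordinate sum [m] confines [s] to a cube of side [n].
    It gives no lower bound in a coordinate that is not a label, hence the alternative [a i = 0]. *)
Lemma grid_labelling (n m : nat) (c : {ffun 'I_n.+1 -> 'I_m.+1} -> 'I_n.+1) :
  exists (a : 'I_n.+1 -> nat) (s : {set {ffun 'I_n.+1 -> 'I_m.+1}}),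
  [/\ s != finset.set0,
      forall x, x \in s -> (\sum_i x i = m)%N /\ forall i, (a i <= x i <= a i + n)%N &
      forall i, a i = 0%N \/ exists2 x, x \in s & c x = i].
Proof.
pose T : finType := {x : {ffun 'I_n.+1 -> 'I_m.+1} | \sum_i x i == m}%N.
have mk (y : 'I_n.+1 -> nat) : (\sum_i y i = m)%N ->
    exists x : T, forall i, val x i = y i :> nat.
  move=> sum_y; have y_le i : (y i < m.+1)%N by rewrite ltnS -sum_y (bigD1 i) //= leq_addr.
  pose x := [ffun i => Ordinal (y_le i)].
  have xP : (\sum_i x i == m)%N.
    by apply/eqP; rewrite -[RHS]sum_y; apply: eq_bigr => i _; rewrite ffunE.
  by exists (Sub x xP) => i; rewrite SubK ffunE.
have [t0 _] : exists x : T, forall i, val x i = (if i == ord0 then m else 0)%N :> nat.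
  by apply: mk; rewrite -big_mkcond big_pred1_eq.
(* The factor [#|T|] lets the coordinate decide; [enum_rank x], being less than [#|T|], breaks
   ties. *)
pose r (i : 'I_n.+1) (x : T) := (val x i * #|T| + enum_rank x)%N.
have r_lt i (x y : T) : (val x i < val y i)%N -> (r i x < r i y)%N.
  rewrite /r => lt_xy; apply: leq_trans (leq_addr _ _).
  by apply: leq_trans (leq_mul lt_xy (leqnn _)); rewrite mulSnr ltn_add2l ltn_ord.
have r_inj i : injective (r i).
  move=> x y rxy; apply/enum_rank_inj/ord_inj.
  have [/r_lt|/r_lt|e] := ltngtP (val x i) (val y i).
  - by rewrite rxy ltnn.
  - by rewrite rxy ltnn.
  - by apply/eqP; rewrite -(eqn_add2l (val x i * #|T|)) {2}e; apply/eqP.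
have [|s Hs] := scarf (c \o val) r_inj; first by apply/card_gt0P; exists t0.
set C := imset _ _ in Hs.
have [i1 i1C _] := Hs t0.
have /imsetP[x0 x0s _] := i1C.
pose q i := [arg min_(x < x0 in s) (val (x : T) i : nat)].
have qs i : q i \in s by rewrite /q; case: arg_minnP.
have qle i (x : T) : x \in s -> (val (q i) i <= val x i)%N.
  by rewrite /q; case: arg_minnP => // ? _ H /H.
pose a i := if i \in C then val (q i) i : nat else 0%N.
have a_le i (x : T) : x \in s -> (a i <= val x i)%N by rewrite /a; case: ifP => // _ /qle.
have sumT (x : T) : (\sum_i val x i = m)%N by apply/eqP/(valP x).
(* Otherwise a grid point would exceed the minima in all labelled coordinates. *)
have sum_a : (m <= \sum_i a i + n)%N.
  rewrite leqNgt; apply/negP => lt_m.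
  pose b i := if i \in C then (a i).+1 else 0%N.
  have sum_b : (\sum_i b i <= m)%N.
    apply: leq_trans (_ : \sum_i (a i + 1) <= _)%N.
      by apply: leq_sum => i _; rewrite /b; case: ifP; rewrite ?addn1.
    by rewrite big_split /= sum_nat_const card_ord muln1 addnS.
  have [|y Hy] := mk (fun i => b i + (if i == i1 then m - \sum_j b j else 0))%N.
    by rewrite big_split /= -[X in (_ + X)%N]big_mkcond big_pred1_eq subnKC.
  have [i iC /(_ _ (qs i))] := Hs y; apply/negP; rewrite -ltnNge; apply: r_lt.
  by rewrite Hy /b /a iC ltn_addr.
exists a, (val @: s)%SET; split.
- by apply/set0Pn; exists (val x0); rewrite imset_f.
- move=> _ /imsetP[x xs ->]; split=> // i; rewrite a_le //=.
  (* The other coordinates are at least [a j], and the [a j] together miss [m] by at most [n]; this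
     bounds coordinate [i] from above. *)
  have le_a : (\sum_(j < n.+1 | j != i) a j <= \sum_(j < n.+1 | j != i) sval x j)%N.
    by apply: leq_sum => j _; exact: a_le.
  have sx := sumT x; rewrite (bigD1 i) //= in sx.
  move: sum_a; rewrite (bigD1 i) //= => sum_a.
  rewrite -(leq_add2r (\sum_(j < n.+1 | j != i) sval x j)%N) sx.
  by rewrite (leq_trans sum_a) // addnAC leq_add2l.
- move=> i; rewrite /a; case: ifPn => [/imsetP[x xs ->]|]; last by left.
  by right; exists (val x); rewrite ?imset_f.
Qed.

Definition std_simplex (R : realType) (n : nat) : set 'rV[R]_n :=
  [set t | (forall i, 0 <= t ord0 i) /\ \sum_i t ord0 i = 1].

Lemma std_simplex_compact (R : realType) (n : nat) : compact (@std_simplex R n).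
Proof.
apply: (@subclosed_compact _ _ [set t : 'rV[R]_n | forall i, t ord0 i \in `[0, 1]]).
- have -> : @std_simplex R n = (\bigcap_(i in [set: 'I_n]) [set t : 'rV[R]_n | 0 <= t ord0 i])
      `&` [set t : 'rV[R]_n | \sum_i t ord0 i = 1].
    by apply/seteqP; split => t /= [t0 t1]; split => // i; [move=> _|]; exact: t0.
  apply: closedI.
    apply: closed_bigI => i _.
    apply: (@preimage_closed _ _ (fun t : 'rV[R]_n => t ord0 i) [set x | 0 <= x]).
      by move=> t _; exact: coord_continuous.
    exact: closed_ge.
  apply: (@preimage_closed _ _ (fun t : 'rV[R]_n => \sum_i t ord0 i) [set x | x = 1]);
    last exact: closed_eq.
  move=> t _; move: t; apply: (continuous_big (op := +%R)) => [|i _].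
    exact: add_continuous.
  exact: coord_continuous.
- apply: (@rV_compact _ _ (fun=> `[(0:R), 1]%classic)) => i; exact: segment_compact.
- move=> t [t0 t1] i; rewrite /= in_itv /= t0 /= -t1 (bigD1 i) //= lerDl.
  by apply: sumr_ge0.
Qed.

(** Replaces the choice of subsequences: several sequences in compact sets converge along one and
    the same ultrafilter. *)
Lemma ultra_cvg_compact (I : Type) (T : topologicalType) (K : set T)
    (G : set_system I) (u : I -> T) :
  UltraFilter G -> compact K -> (forall i, K (u i)) ->
  exists2 p, K p & u @ G --> p.
Proof.
move=> GU; rewrite compact_ultra => cptK uK.
have uGU : UltraFilter (u @ G).
  split=> [|H HF uGH]; first exact: fmap_proper_filter.
  apply/seteqP; split=> A; last exact: uGH.
  move=> HA; have [//|GnA] := in_ultra_setVsetC (u @^-1` A) GU.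
  have HnA : H (~` A) by apply: uGH.
  by have [x []] := filter_ex (filterI HA HnA).
have [|p [Kp up]] := cptK _ uGU; last by exists p.
by rewrite /=; apply: (@filterE _ G).
Qed.

Lemma within_continuous_cvg (I : Type) (S T : topologicalType) (A : set S)
    (f : S -> T) (G : set_system I) (u : I -> S) (p : S) : Filter G ->
  {within A, continuous f} -> A p -> (forall i, A (u i)) ->
  u @ G --> p -> (f \o u) @ G --> f p.
Proof.
move=> GF /subspace_continuousP fc Ap uA up.
apply: cvg_comp (fc p Ap) => P; rewrite /= /within /= => /up.
by apply: (@filterS _ G) => i; apply; exact: uA.
Qed.

Lemma near_fixpoint (R : realType) (n : nat) (g : 'rV[R]_n.+1 -> 'rV[R]_n.+1) (e : R) :
  (forall t, std_simplex t -> std_simplex (g t)) -> 0 < e ->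
  exists t, std_simplex t /\ forall i,
    exists u, [/\ std_simplex u, `|u - t| <= e & u ord0 i <= g u ord0 i + e].
Proof.
(* Scarf's set extends over at most [n] grid steps of length [1 / m] in each coordinate, so
   [n / m < e] is what is needed. *)
move=> gS e0; pose m := (Num.truncn (n%:R / e)).+1.
have n_lt : n%:R < e * m%:R.
  by rewrite mulrC -ltr_pdivrMr // truncnS_gt.
have m0 : 0 < m%:R :> R by rewrite ltr0n.
pose pt (x : {ffun 'I_n.+1 -> 'I_m.+1}) : 'rV[R]_n.+1 := \row_i ((x i)%:R / m%:R).
have ptS (x : {ffun 'I_n.+1 -> 'I_m.+1}) : (\sum_i x i = m)%N -> std_simplex (pt x).
  move=> sum_x; split=> [i|]; first by rewrite mxE divr_ge0.
  under eq_bigr do rewrite mxE.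
  by rewrite -mulr_suml -natr_sum sum_x divff // gt_eqF.
have ex_le t : std_simplex t -> exists i, t ord0 i <= g t ord0 i.
  move=> tS; apply: contrapT => /forallNP H.
  have : \sum_i g t ord0 i < \sum_i t ord0 i.
    apply: ltr_sum; first by apply/hasP; exists ord0; rewrite ?mem_index_enum.
    by move=> i _; rewrite ltNge; apply/negP/H.
  by rewrite (gS _ tS).2 tS.2 ltxx.
have /choice[c Hc] (x : {ffun 'I_n.+1 -> 'I_m.+1}) :
    exists i, (\sum_i x i = m)%N -> pt x ord0 i <= g (pt x) ord0 i.
  have [sum_x|nx] := pselect (\sum_i x i = m)%N; last by exists ord0.
  by have [i Hi] := ex_le _ (ptS _ sum_x); exists i.
have [a [s [/set0Pn[x xs] sa ac]]] := grid_labelling c.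
have [sum_x ax] := sa x xs.
exists (pt x); split; first exact: ptS.
have close y : y \in s -> `|pt y - pt x| <= e.
  move=> ys; have [sum_y ay] := sa y ys.
  rewrite [leLHS]/Num.norm /= mx_normrE; apply: bigmax_le; first exact: ltW.
  move=> [i j] _ /=; rewrite !mxE -mulrBl normrM [`|_^-1|]gtr0_norm ?invr_gt0 //.
  rewrite ler_pdivrMr //; apply: le_trans (ltW n_lt).
  have /andP[ax1 ax2] := ax j; have /andP[ay1 ay2] := ay j.
  rewrite ler_distl lerBlDr -!natrD !ler_nat.
  by rewrite (leq_trans ax2) ?(leq_trans ay2) ?leq_add2r.
(* If [a i = 0], coordinate [i] is at most [n / m], hence below [e], and [g] has nonnegative
   coordinates. *)
move=> i; have [a0|[y ys cy]] := ac i.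
  exists (pt x); split; [exact: ptS|by rewrite subrr normr0 ltW|].
  apply: le_trans (_ : e <= _); last by rewrite lerDr (gS _ (ptS _ sum_x)).1.
  rewrite mxE ler_pdivrMr //; apply: le_trans (ltW n_lt).
  by rewrite ler_nat; have := ax i; rewrite a0 add0n => /andP[].
have [sum_y _] := sa y ys.
exists (pt y); split; [exact: ptS|exact: close|].
by rewrite -cy; apply: le_trans (Hc _ sum_y) _; rewrite lerDl ltW.
Qed.

Theorem brouwer_simplex (R : realType) (n : nat) (g : 'rV[R]_n.+1 -> 'rV[R]_n.+1) :
  {within @std_simplex R n.+1, continuous g} ->
  (forall t, std_simplex t -> std_simplex (g t)) ->
  exists2 t, std_simplex t & g t = t.
Proof.
move=> gc gS.
have [x Hx] := choice (fun k => near_fixpoint gS (harmonic_gt0 k)).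
pose S t := @std_simplex R n.+1 t.
have xS k : S (x k) by have [] := Hx k.
have [G [GU ooG]] := ultraFilterLemma (_ : ProperFilter \oo).
have [p pS xp] := ultra_cvg_compact GU (@std_simplex_compact R n.+1) xS.
have le_p i : p ord0 i <= g p ord0 i.
  have /choice[u Hu] k := (Hx k).2 i.
  have uS k : S (u k) by have [] := Hu k.
  have h0 : @harmonic R @ G --> (0 : R).
    by move=> P /(@cvg_harmonic R) /ooG.
  have ux : (fun k => u k - x k) @ G --> (0 : 'rV[R]_n.+1).
    apply/norm_cvg0P; apply: (squeeze_cvgr _ (cvg_cst (0 : R)) h0).
    by apply: filterE => k; rewrite normr_ge0; have [] := Hu k.
  have up : u @ G --> p.
    have -> : u = (fun k => u k - x k) + x by apply/funext => k /=; rewrite fctE subrK.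
    by rewrite -[p]add0r; exact: cvgD.
  have gup : (g \o u) @ G --> g p by exact: within_continuous_cvg gc pS uS up.
  have co (v : nat -> 'rV[R]_n.+1) (q : 'rV[R]_n.+1) :
      v @ G --> q -> (fun k => v k ord0 i) @ G --> q ord0 i.
    apply: (@continuous_cvg _ _ _ G _ v (fun M : 'rV[R]_n.+1 => M ord0 i)).
    exact: coord_continuous.
  have := ler_cvg_to (co _ _ up) (cvgD (co _ _ gup) h0); rewrite addr0; apply.
  by apply: filterE => k; have [] := Hu k.
(* Both points have coordinate sum 1, so no coordinate can grow strictly. *)
exists p => //; apply/esym/rowP => i; apply/eqP; rewrite -subr_eq0 -oppr_eq0 opprB.
have : \sum_i (g p ord0 i - p ord0 i) == 0.
  by rewrite sumrB pS.2 (gS _ pS).2 subrr.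
rewrite psumr_eq0 => [/allP/(_ i)|j _]; last by rewrite subr_ge0.
by rewrite mem_index_enum => /(_ isT).
Qed.

(** * Schauder's approximation and the compactness argument *)

(* The constant [1] keeps the infimum finite when [U] is the whole space. *)
Definition depth (R : realType) (X : normedModType R) (U : set X) (x : X) : R :=
  inf [set r | r = 1 \/ exists2 y, ~ U y & r = `|x - y|].

Lemma depth_le (R : realType) (X : normedModType R) (U : set X) (x : X) (r : R) :
  r = 1 \/ (exists2 y, ~ U y & r = `|x - y|) -> depth U x <= r.
Proof.
move=> Hr; apply: ge_inf; last exact: Hr.
by exists 0 => _ [->|[y _ ->]]; [exact: ler01|exact: normr_ge0].
Qed.

Lemma le_depth (R : realType) (X : normedModType R) (U : set X) (x : X) (a : R) :
  a <= 1 -> (forall y, ~ U y -> a <= `|x - y|) -> a <= depth U x.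
Proof.
move=> a1 aU; apply: lb_le_inf; first by exists 1; left.
by move=> _ [->//|[y /aU ay ->]].
Qed.

Lemma depth_itv (R : realType) (X : normedModType R) (U : set X) (x : X) :
  0 <= depth U x <= 1.
Proof. by rewrite le_depth ?ler01//= depth_le //; left. Qed.

Lemma depth_gt0 (R : realType) (X : normedModType R) (U : set X) (x : X) :
  0 < depth U x <-> interior U x.
Proof.
split=> [d0|/nbhs_ballP[e /= e0 eU]].
  apply/nbhs_ballP; exists (depth U x) => //= y; rewrite -ball_normE /= => xy.
  by apply: contrapT => nUy; move: xy; rewrite ltNge depth_le //; right; exists y.
apply: lt_le_trans (_ : Num.min 1 e <= _); first by rewrite lt_min ltr01.
apply: le_depth => [|y nUy]; rewrite ge_min ?lexx //.
apply/orP; right; rewrite leNgt; apply/negP => xy.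
by apply/nUy/eU; rewrite -ball_normE.
Qed.

Lemma depth_continuous (R : realType) (X : normedModType R) (U : set X) :
  continuous (depth U).
Proof.
have lip x y : depth U x - `|x - y| <= depth U y.
  apply: le_depth => [|w nUw].
    by rewrite lerBlDr (le_trans (andP (depth_itv U x)).2) // lerDl.
  rewrite lerBlDl (le_trans _ (ler_distD y x w)) // depth_le //.
  by right; exists w.
move=> x; apply/cvgrPdist_lt => e e0; near=> y.
have xy : `|x - y| < e by near: y; exact: cvgr_dist_lt.
apply: le_lt_trans xy; rewrite ler_distl -[X in _ && X]lerBlDr lip andbT.
by rewrite distrC lip.
Unshelve. all: by end_near. Qed.

Lemma precompact_net (R : realType) (X : normedModType R) (A : set X) (e : R) :
  precompact A -> 0 < e ->
  exists s : seq X, forall x, A x -> exists2 y, y \in s & `|x - y| < e.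
Proof.
rewrite precompactE compact_cover => cptA e0.
have [|x /subset_closure Ax|D _ AD] := cptA X setT (fun x => ball x e).
- by move=> x _; exact: ball_open.
- by exists x => //; exact: ballxx.
have /finite_seqP[s sD] := finite_fset D.
exists s => x /subset_closure/AD[y]; rewrite sD -ball_normE /= distrC => ys.
by exists y.
Qed.

(** Where [d] vanishes [q] may jump, but it is bounded and gets damped to 0. Weights built from [f],
    which is controlled only on [U], thus become continuous on the whole space. *)
Lemma continuous_damped (R : realType) (T : topologicalType) (d q : T -> R) :
  continuous d -> (forall x, 0 <= d x) -> (forall x, 0 <= q x <= 1) ->
  (forall x, 0 < d x -> {for x, continuous q}) ->
  continuous (fun x => d x * q x).
Proof.
move=> dc d0 q01 qc x; have := d0 x; rewrite le_eqVlt => /predU1P[dx0|/qc qx].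
  rewrite /continuous_at -dx0 mul0r.
  apply: (squeeze_cvgr _ (cvg_cst (0 : R)) (_ : d @ x --> 0)).
    apply: filterE => y; have /andP[qy0 qy1] := q01 y.
    by rewrite mulr_ge0 //= ler_piMr.
  by rewrite dx0; exact: dc.
by apply: cvgM; [exact: dc|exact: qx].
Qed.

Lemma row_continuous (R : realType) (T : topologicalType) (n : nat) (h : T -> 'rV[R]_n) :
  (forall i, continuous (fun t => h t ord0 i)) -> continuous h.
Proof.
move=> hc t; apply/cvgrPdist_le => e e0.
have near_i i : \forall u \near t, `|h t ord0 i - h u ord0 i| <= e.
  by have /cvgrPdist_le := hc i t; exact.
apply: filterS (filter_forall _ near_i) => u Hu.
rewrite [leLHS]/Num.norm /= mx_normrE; apply: bigmax_le; first exact: ltW.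
by move=> [i j] _ /=; rewrite !mxE ord1.
Qed.

Lemma damped_approx_solution (R : realType) (X : normedModType R) (U : set X)
    (f : X -> X) (d : X -> R) (z : X) (l e : R) :
  {within U, continuous f} -> precompact (f @` U) -> continuous d ->
  (forall x, 0 <= d x <= 1) -> (forall x, 0 < d x -> interior U x) -> 0 < e ->
  exists x v, x = z - (l * d x) *: (f x + v) /\ `|v| <= e.
Proof.
move=> fc fpre dc d01 dU e0.
have d0 x : 0 <= d x by have /andP[] := d01 x.
have [s net] := precompact_net fpre e0.
(* Node 0 is the zero vector: the map [T] below parks there the mass [1 - d] that is left over,
   without changing the combination of the nodes. *)
pose n := size s; pose y (i : 'I_n.+1) : X := (0 :: s)`_i.
pose w i x : R := Num.max 0 (e - `|f x - y i|).
have w0 i x : 0 <= w i x by rewrite le_max lexx.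
pose W x := \sum_i w i x.
(* Where [W] vanishes, the convention for the inverse of 0 gives [q i x = 0], so the bounds on [q]
   hold everywhere. *)
pose q i x := w i x / W x.
have W_ge i x : w i x <= W x by rewrite /W (bigD1 i) //= lerDl sumr_ge0.
have W0 x : 0 <= W x by rewrite sumr_ge0.
have q01 i x : 0 <= q i x <= 1.
  rewrite /q divr_ge0 //=; have := W0 x; rewrite le_eqVlt => /predU1P[<-|Wx].
    by rewrite invr0 mulr0.
  by rewrite ler_pdivrMr // mul1r.
have W_gt0 x : U x -> 0 < W x.
  move=> Ux; have [u us fxu] : exists2 u, u \in s & `|f x - u| < e by apply: net; exists x.
  have iP : ((index u s).+1 < n.+1)%N by rewrite ltnS index_mem.
  apply: lt_le_trans (W_ge (Ordinal iP) x).
  by rewrite lt_max /y /= nth_index // subr_gt0 fxu orbT.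
have sum_q x : U x -> \sum_i q i x = 1.
  by move=> Ux; rewrite -mulr_suml divff // gt_eqF // W_gt0.
have w_cont i x : interior U x -> {for x, continuous (w i)}.
  move=> Ux; have fx : {for x, continuous f}.
    have /subspace_continuousP/(_ x (interior_subset Ux)) := fc.
    by rewrite within_interior.
  apply: continuous_max; first exact: cvg_cst.
  apply: cvgB; first exact: cvg_cst.
  by apply: cvg_norm; apply: cvgB => //; exact: cvg_cst.
have q_cont i : continuous (fun x => d x * q i x).
  apply: continuous_damped => // x /dU Ux.
  have WxU := W_gt0 x (interior_subset Ux).
  apply: cvgM; first exact: w_cont.
  apply: cvgV; first by rewrite gt_eqF.
  apply: cvg_big => [|j _]; [exact: add_continuous|exact: w_cont].
pose p (t : 'rV[R]_n.+1) : X := z - l *: \sum_i t ord0 i *: y i.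
have p_cont : continuous p.
  move=> t; apply: (@cvgB _ _ _ (nbhs t) (nbhs_filter t) (fun=> z)); first exact: cvg_cst.
  apply: (@cvgZ _ _ _ (nbhs t) (nbhs_filter t)); first exact: cvg_cst.
  move: t; apply: (continuous_big (op := +%R)) => [|i _ t]; first exact: add_continuous.
  by apply: (@cvgZr_tmp _ _ _ (nbhs t) (nbhs_filter t)); exact: coord_continuous.
pose T t : 'rV[R]_n.+1 :=
  \row_i (d (p t) * q i (p t) + (1 - d (p t)) * (i == ord0)%:R).
have T_cont : continuous T.
  apply: row_continuous => i; under eq_fun do rewrite mxE.
  have H_cont : continuous (fun x => d x * q i x + (1 - d x) * (i == ord0)%:R).
    move=> x; apply: cvgD; first exact: q_cont.
    by apply: cvgMr_tmp; apply: cvgB; [exact: cvg_cst|exact: dc].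
  by move=> t; apply: (continuous_comp (p_cont t) (H_cont _)).
have sum_dq x : \sum_i d x * q i x = d x.
  have := d0 x; rewrite le_eqVlt -mulr_sumr => /predU1P[<-|/dU Ux].
    by rewrite mul0r.
  by rewrite sum_q ?mulr1 //; exact: interior_subset.
have sum_delta : \sum_(i < n.+1) (i == ord0)%:R = 1 :> R.
  by rewrite (bigD1 ord0) //= big1 ?addr0 // => i /negPf->.
have T_simplex t : std_simplex t -> std_simplex (T t).
  move=> _; split=> [i|].
    have /andP[dp0 dp1] := d01 (p t); have /andP[qp0 _] := q01 i (p t).
    by rewrite mxE addr_ge0 // mulr_ge0 // subr_ge0.
  under eq_bigr do rewrite mxE.
  by rewrite big_split /= sum_dq -mulr_sumr sum_delta mulr1 addrC subrK.
have [t _ tE] := brouwer_simplex (continuous_subspaceT T_cont) T_simplex.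
have pE : p t = z - l *: \sum_i (d (p t) * q i (p t)) *: y i.
  rewrite {1}/p; congr (z - l *: _); apply: eq_bigr => i _.
  rewrite -{1}tE mxE scalerDl; have [->|_] := eqVneq i ord0.
    by rewrite /y /= !scaler0 addr0.
  by rewrite mulr0 scale0r addr0.
(* At depth 0 the equation reduces to [p t = z] and [v = 0] serves. Otherwise [v] is the weighted
   mean of the errors [y i - f (p t)], and nodes of nonzero weight have error below [e]. *)
have := d0 (p t); rewrite le_eqVlt => /predU1P[dp0|/dU/interior_subset Up].
  exists (p t), 0; rewrite normr0 ltW // -dp0 mulr0 scale0r; split=> //.
  by rewrite {1}pE big1 ?scaler0 // => i _; rewrite -dp0 mul0r scale0r.
exists (p t), (\sum_i q i (p t) *: (y i - f (p t))); split.
  rewrite {1}pE; congr (z - _); rewrite -scalerA; congr (_ *: _).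
  under [in RHS]eq_bigr do rewrite scalerBr.
  rewrite sumrB -scaler_suml sum_q // scale1r addrC subrK scaler_sumr.
  by apply: eq_bigr => i _; rewrite scalerA.
apply: le_trans (ler_norm_sum _ _ _) _.
rewrite -[leRHS]mulr1 -(sum_q _ Up) mulr_sumr; apply: ler_sum => i _.
have /andP[qp0 _] := q01 i (p t).
rewrite normrZ ger0_norm // mulrC.
have := w0 i (p t); rewrite le_eqVlt => /predU1P[wi|].
  by rewrite /q -wi mul0r !mulr0.
rewrite lt_max ltxx /= subr_gt0 distrC => /ltW fy.
exact: ler_wpM2r.
Qed.

Theorem zero_in_closure_image (R : realType) (X : normedModType R) (U : set X)
    (f : X -> X) (z : X) (s : R) :
  bounded_set U -> closed U -> {within U, continuous f} -> precompact (f @` U) ->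
  interior U z -> s != 0 ->
  (forall x (r : R), boundary U x -> 0 <= r -> x <> z - (s * r) *: f x) ->
  closure (f @` U) 0.
Proof.
move=> Ubnd Ucl fc fpre Uz s0 nofix.
apply: contrapT => ncl.
have [c c0 fc0] : exists2 c : R, 0 < c & forall x, U x -> c <= `|f x|.
  apply: contrapT => H; apply: ncl => B /nbhs_ballP[c /= c0 cB].
  apply: contrapT => H'; apply: H; exists c => // x Ux; rewrite leNgt; apply/negP => fxc.
  apply: H'; exists (f x); split; first by exists x.
  by apply: cB; rewrite -ball_normE /= sub0r normrN.
have [M M0 UM] := pinfty_ex_gt0 Ubnd.
have c20 : 0 < c / 2 by rewrite divr_gt0.
(* The bound [c / 2] keeps [f (x k) + v k] away from 0; the harmonic bound makes [v] tend to 0. *)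
pose e k := Num.min (c / 2) (harmonic k).
have e0 k : 0 < e k by rewrite lt_min c20 harmonic_gt0.
have /choice[x Hx] k : exists x, exists v,
    x = z - (s * k.+1%:R * depth U x) *: (f x + v) /\ `|v| <= e k.
  apply: damped_approx_solution => //; first exact: depth_continuous.
    exact: depth_itv.
  by move=> x; case: (depth_gt0 U x).
have {Hx} /choice[v Hv] := Hx.
pose r k := k.+1%:R * depth U (x k).
have r0 k : 0 <= r k by rewrite mulr_ge0 //; have /andP[] := depth_itv U (x k).
have xE k : x k = z - (s * r k) *: (f (x k) + v k) by have [] := Hv k; rewrite -mulrA.
have xU k : U (x k).
  (* At depth 0 the equation would give [x k = z], an interior point, whose depth is positive. *)
  have [_] := depth_gt0 U z; have /andP[+ _] := depth_itv U (x k).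
  rewrite le_eqVlt => /predU1P[dx0 /(_ Uz)|/depth_gt0/interior_subset//].
  suff <- : x k = z by rewrite -dx0 ltxx.
  by rewrite xE /r -dx0 !mulr0 scale0r subr0.
have fv k : c / 2 <= `|f (x k) + v k|.
  have /fc0 := xU k; have [_] := Hv k; rewrite le_min => /andP[vc _] fxc.
  rewrite -[f (x k) + v k]opprK normrN opprD; apply: le_trans (lerB_dist _ _).
  by rewrite normrN; lra.
pose K := (M + `|z|) / (`|s| * (c / 2)).
have rK k : 0 <= r k <= K.
  have sc0 : 0 < `|s| * (c / 2) by apply: mulr_gt0; rewrite ?normr_gt0.
  rewrite r0 /= ler_pdivlMr //.
  apply: le_trans (_ : `|x k - z| <= _); last first.
    by rewrite (le_trans (ler_normB _ _)) // lerD2r; exact: UM.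
  rewrite {1}xE addrC addKr normrN normrZ normrM (ger0_norm (r0 k)).
  by rewrite mulrCA mulrA ler_wpM2l // mulr_ge0.
have [G [GU ooG]] := ultraFilterLemma (_ : ProperFilter \oo).
have cptF : compact (closure (f @` U)) by move: fpre; rewrite precompactE.
have fxF i : closure (f @` U) (f (x i)).
  by apply: subset_closure; exists (x i).
have [y _ fy] := ultra_cvg_compact GU cptF fxF.
have [r_ rK_ rr] : exists2 a : R, 0 <= a & r @ G --> a.
  have rin k : `[0, K]%classic (r k) by rewrite /= in_itv /= rK.
  have [a] := ultra_cvg_compact GU (@segment_compact R 0 K) rin.
  by rewrite /= in_itv /= => /andP[a0 _] ra; exists a.
have h0 : @harmonic R @ G --> (0 : R) by move=> P /(@cvg_harmonic R) /ooG.
have v0 : v @ G --> (0 : X).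
  apply/norm_cvg0P; apply: (squeeze_cvgr _ (cvg_cst (0 : R)) h0).
  apply: filterE => k; rewrite normr_ge0 /=; have [_] := Hv k.
  by rewrite le_min => /andP[].
pose x_ := z - (s * r_) *: y.
(* [U] need not be compact: [x] converges because its equation expresses it through the convergent
   [r], [f \o x] and [v]. *)
have xx : x @ G --> x_.
  rewrite (_ : x = fun k => z - (s * r k) *: (f (x k) + v k)); last exact/funext.
  apply: cvgB; first exact: cvg_cst.
  apply: cvgZ; first exact: cvgMl_tmp.
  by rewrite -[y]addr0; exact: cvgD.
have Ux : U x_.
  by apply: (closed_cvg _ Ucl _ _ xx); apply: filterE.
(* The depth of [x k] is [r k / (k + 1)] with [r] bounded. *)
have dx : depth U x_ = 0.
  have d1 : (depth U \o x) @ G --> depth U x_.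
    exact: cvg_comp xx (@depth_continuous _ _ U x_).
  have d2 : (depth U \o x) @ G --> 0.
    rewrite -[0](mulr0 r_); rewrite (_ : _ \o _ = fun k => r k * harmonic k).
      exact: cvgM.
    by apply/funext => k /=; rewrite /r mulrC mulKf // pnatr_eq0.
  exact: (cvg_unique _ d1 d2).
have fx : f x_ = y.
  have fx1 : (f \o x) @ G --> f x_ by exact: within_continuous_cvg fc Ux xU xx.
  exact: (cvg_unique _ fx1 fy).
apply: (nofix x_ r_) => //; last by rewrite fx.
split; first exact: subset_closure.
by move=> /depth_gt0; rewrite dx ltxx.
Qed.

Unset Implicit Arguments.

Theorem theorem3p1 (R : realType) (X : completeNormedModType R)
    (U : set X) (f : X -> X)
    (U_nonempty : U !=set0) (U_bounded : bounded_set U) (U_closed : closed U)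
    (intU_nonempty : interior U !=set0)
    (f_cc : completely_continuous U f)
    (B : X -> X -> R)
    (B_pos : forall x : X, x != 0 -> 0 < B x x)
    (B_homog : forall (x : X) (l : R), B (l *: x) x = l * B x x)
    (z : X) (z_int : interior U z)
    (constant_sign :
      (forall x : X, boundary U x -> 0 <= B (f x) (x - z)) \/
      (forall x : X, boundary U x -> B (f x) (x - z) <= 0)) :
  closure (f @` U) 0 /\
  (~ (boundary (f @` U) `\` (f @` U)) 0 -> (f @` U) 0).
Proof.
have [fcpt fc] := f_cc.
have fpre : precompact (f @` U) by exact: fcpt.
have [s [s0 Bs]] : exists s : R, s != 0 /\
    forall x, boundary U x -> 0 <= s * B (f x) (x - z).
  case: constant_sign => HB.
    by exists 1; split=> [|x /HB]; rewrite ?oner_neq0 ?mul1r.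
  by exists (-1); split=> [|x /HB]; rewrite ?oppr_eq0 ?oner_neq0 // mulN1r oppr_ge0.
have cl0 : closure (f @` U) 0.
  apply: (@zero_in_closure_image _ _ _ _ z s) => // x r bx r0 xE.
  have u0 : x - z != 0.
    by rewrite subr_eq0; apply/eqP => xz; have [_] := bx; rewrite xz.
  have xzE : x - z = - (s * r) *: f x by rewrite {1}xE addrC addKr scaleNr.
  have r_gt0 : 0 < r.
    rewrite lt_def r0 andbT; apply: contra_neq u0 => r_eq0.
    by rewrite xzE r_eq0 mulr0 oppr0 scale0r.
  (* By homogeneity [s * B (f x) (x - z)] then equals [- r^-1 * B (x - z) (x - z)], which is
     negative, against the choice of [s]. *)
  have fE : f x = - (s * r)^-1 *: (x - z).
    by rewrite xzE scalerA mulrNN mulVf ?scale1r // mulf_neq0 // gt_eqF.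
  have := Bs x bx; rewrite fE B_homog mulrA mulrN invfM mulrA divff // mul1r mulNr.
  by rewrite oppr_ge0 leNgt mulr_gt0 ?invr_gt0 ?B_pos.
split=> // nbd; apply: contrapT => nf0; apply: nbd; split=> //; split=> //.
by move=> /interior_subset.
Qed.
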